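(* Let $a\in\mathbb{D}$, $a\neq 0$. Then 1. $N(C_a+I)^\perp\cap\mathcal{E}=\{0\}$. 2. $N(C_a-I)^\perp\cap\mathcal{O}=\{0\}$.
   Context: $\mathbb{D}=\{z\in\mathbb{C}:|z|<1\}$, $\mathbb{T}=\{z\in\mathbb{C}:|z|=1\}$, and $\mathcal{H}=L^2(\mathbb{T})$ with respect to normalized Lebesgue measure. For $a\in\mathbb{D}$, $\varphi_a(z)=\frac{a-z}{1-\bar a z}$ and $C_a:\mathcal{H}\to\mathcal{H}$ is the bounded composition operator $C_af=f\circ\varphi_a$ (so $C_a^2=I$). $\mathcal{E}\subset\mathcal{H}$ is the closed subspace of even elements ($f(-z)=f(z)$ a.e. in $\mathbb{T}$) and $\mathcal{O}\subset\mathcal{H}$ the closed subspace of odd elements ($f(-z)=-f(z)$ a.e.). $N(T)$ denotes the nullspace of $T$, and $\perp$ denotes orthogonal complement in $\mathcal{H}$. *)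

(* Defs.v *)
From HB Require Import structures.
From mathcomp Require Import all_boot all_order all_algebra.
From mathcomp Require Import all_classical all_reals all_analysis.
From mathcomp Require Import measurable_realfun.
From mathcomp.real_closed Require Import complex.

Set Implicit Arguments.
Unset Strict Implicit.
Unset Printing Implicit Defensive.

Import Order.TTheory GRing.Theory Num.Theory.
Import numFieldNormedType.Exports.

Local Open Scope classical_set_scope.
Local Open Scope ring_scope.

Definition complex_xy (R : realType) (z : R[i]) : R * R :=
  (complex.Re z, complex.Im z).

HB.instance Definition _ (R : realType) := isPointed.Build R[i] 0.

(* The Borel sigma-algebra of the complex plane, transported from R * R. *)
HB.instance Definition _ (R : realType) :=
  Measurable.copy R[i] (g_sigma_algebra_preimageType (@complex_xy R)).

Record circle (R : realType) :=
  Circle { circle_val :> R[i] ; _ : `|circle_val| == 1 }.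

HB.instance Definition _ (R : realType) := [isSub for @circle_val R].
HB.instance Definition _ (R : realType) := [Choice of circle R by <:].

Lemma norm_circle (R : realType) (z : circle R) : `|z : R[i]| = 1.
Proof. by case: z => z /= /eqP. Qed.

Lemma circle1_subproof (R : realType) : `|1 : R[i]| == 1.
Proof. by rewrite normr1. Qed.

HB.instance Definition _ (R : realType) :=
  isPointed.Build (circle R) (Circle (circle1_subproof R)).

(* The trace on the circle of the Borel sigma-algebra of the plane. *)
HB.instance Definition _ (R : realType) :=
  Measurable.copy (circle R) (g_sigma_algebra_preimageType (@circle_val R)).

Lemma expi_subproof (R : realType) (t : R) : `|Complex (cos t) (sin t)| == 1.
Proof. by rewrite normc_def /= cos2Dsin2 sqrtr1. Qed.

Definition expi (R : realType) (t : R) : circle R := Circle (expi_subproof t).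

Lemma measurable_expi (R : realType) : measurable_fun [set: R] (@expi R).
Proof.
move=> _ _ [_ [B mB <-] <-]; rewrite setTI !setTI.
have mcs : measurable_fun [set: R] (fun t : R => (cos t, sin t)).
  apply/measurable_fun_pair; apply: continuous_measurable_fun.
    exact: continuous_cos.
  exact: continuous_sin.
by have := mcs measurableT B mB; rewrite setTI.
Qed.

Definition expi_mfun (R : realType) : {mfun measurableTypeR R >-> circle R} :=
  HB.pack (@expi R) (@isMeasurableFun.Build _ _ (measurableTypeR R) (circle R)
    (@expi R) (@measurable_expi R)).

Section circle_space.
Context (R : realType).
Implicit Types (z : circle R) (f g : circle R -> R[i]).

Lemma pi2_gt0 : 0 < 2 * pi :> R.
Proof. by rewrite mulr_gt0 ?pi_gt0. Qed.

Definition mcircle : probability (circle R) R :=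
  distribution (uniform_prob pi2_gt0) (expi_mfun R).

(* Elements of L^2(T) are handled through measurable representatives: the sets
   of functions below are closed under mcircle-a.e. equality of measurable
   functions, and equality of such sets is equality of the corresponding
   subsets of L^2(T). *)
Definition L2 : set (circle R -> R[i]) :=
  [set f | measurable_fun setT f /\
    (\int[mcircle]_z ((Normc.normc (f z)) ^+ 2)%:E < +oo)%E].

Definition L2_zero : set (circle R -> R[i]) :=
  [set f | L2 f /\ f = (fun=> 0) %[ae mcircle]].

Definition cintegral f : R[i] :=
  Complex (Rintegral mcircle setT (fun z => complex.Re (f z)))
          (Rintegral mcircle setT (fun z => complex.Im (f z))).

Definition L2_dot f g : R[i] := cintegral (fun z => f z * conjc (g z)).

Definition L2_orth (S : set (circle R -> R[i])) : set (circle R -> R[i]) :=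
  [set f | L2 f /\ forall g, S g -> L2_dot f g = 0].

(* Meant for maps T on representatives that respect mcircle-a.e. equality. *)
Definition L2_null (T : (circle R -> R[i]) -> circle R -> R[i]) :
    set (circle R -> R[i]) :=
  [set f | L2 f /\ T f = (fun=> 0) %[ae mcircle]].

Lemma circle_opp_subproof z : `|- (z : R[i])| == 1.
Proof. by rewrite normrN norm_circle. Qed.

Definition circle_opp z : circle R := Circle (circle_opp_subproof z).

Definition L2_even : set (circle R -> R[i]) :=
  [set f | L2 f /\ f \o circle_opp = f %[ae mcircle]].

Definition L2_odd : set (circle R -> R[i]) :=
  [set f | L2 f /\ f \o circle_opp = \- f %[ae mcircle]].

Definition phi (a z : R[i]) : R[i] := (a - z) / (1 - conjc a * z).

Lemma phi_circle_subproof (a : R[i]) (ha : `|a| < 1) z : `|phi a z| == 1.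
Proof.
have zz : (z : R[i]) * conjc z = 1 by rewrite -sqr_normc norm_circle expr1n.
have -> : phi a z = (a - circle_val z) / (circle_val z * conjc (circle_val z - a)).
  by rewrite /phi rmorphB /= mulrBr zz [conjc a * _]mulrC.
rewrite normrM normfV normrM norm_circle mul1r normcJ distrC divff//.
rewrite normr_eq0 subr_eq0; apply: contraTneq ha => <-.
by rewrite norm_circle ltxx.
Qed.

Definition phi_circle (a : R[i]) (ha : `|a| < 1) z : circle R :=
  Circle (phi_circle_subproof ha z).

Definition comp_phi (a : R[i]) (ha : `|a| < 1) f : circle R -> R[i] :=
  f \o phi_circle ha.

End circle_space.

Arguments L2_even R : clear implicits.
Arguments L2_odd R : clear implicits.
Arguments L2_zero R : clear implicits.

(* Main.v *)
From HB Require Import structures.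
Require Import Defs.
From mathcomp Require Import all_boot all_order all_algebra.
From mathcomp Require Import all_classical all_reals all_analysis.
From mathcomp.real_closed Require Import complex.
From mathcomp Require Import measurable_realfun ring lra.

Import Order.TTheory GRing.Theory Num.Theory.

Local Open Scope classical_set_scope.
Local Open Scope ring_scope.

(** The space N(C_a + eps)^perp, eps = 1 or -1, is explored with the test
    functions g = H - eps (H o phi_a), H bounded, measurable and real: since
    phi_a is an involution, C_a g = - eps g. So for f in that space and u the
    real or the imaginary part of f,
      int u (H o phi_a) = eps int u H   for every such H.
    If moreover f (- z) = eps f z a.e., the invariance of the arc length under
    z |-> - z cancels the two signs: the measure u dm is invariant under
      psi z = phi_a (- z) = (a + z) / (1 + conj a z),
    a hyperbolic automorphism of the disc. It pushes every point of the circle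
    except its two fixed points from - a/|a| towards a/|a|, hence no
    nonzero finite measure that is absolutely continuous is invariant under it.

    No iteration is needed to see the last point. The function
    k z = 1 + Re (conj a z) increases along psi: with w = conj a z,
      k (psi z) - k z = 2 (Im w)^2 / |1 + w|^2            ([potential_phi_opp]),
    which is positive off the two points of the circle on the line through 0
    and a, a null set ([mcircle_line0]). If u dm were a positive invariant
    measure, then int u (k o psi - k) = 0 would already force u = 0. For a signed
    u, testing the invariance with H = (1_{u > 0} o psi^-1) k gives
    int u^+ (k o psi - k) <= 0, so u^+ = 0, and likewise u^- = 0
    ([invariant_density_eq0]). *)

(** * Invariant densities and monotone potentials *)

Section monotone_potential.
Context d (T : measurableType d) (R : realType).
Variable mu : {finite_measure set T -> \bar R}.
Implicit Types u k H : T -> R.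

Lemma integrable_mul_bounded u H M : mu.-integrable setT (EFin \o u) ->
  measurable_fun setT H -> (forall x, `|H x| <= M) ->
  mu.-integrable setT (EFin \o (fun x => u x * H x)).
Proof.
move=> iu mH HM.
have /(_ iu mH) := @integrableMl _ _ _ mu setT measurableT (EFin \o u) H.
apply; exists M; split; first exact: num_real.
by move=> N MN x _ /=; rewrite (le_trans (HM x))// ltW.
Qed.

(** Testing with the indicator of [u > 0] carried over by [psi] turns the
    invariance of the signed density [u] into the inequality
    int u^+ (k o psi) <= int u^+ k. *)
Lemma invariant_density_nonpos (psi psi' : T -> T) u k M :
  measurable_fun setT psi -> measurable_fun setT psi' -> cancel psi psi' ->
  mu.-integrable setT (EFin \o u) ->
  measurable_fun setT k -> (forall x, 0 <= k x <= M) ->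
  (forall x, k x <= k (psi x)) ->
  (forall H, measurable_fun setT H -> (forall x, `|H x| <= M) ->
    \int[mu]_x (u x * H (psi x)) = \int[mu]_x (u x * H x)) ->
  {ae mu, forall x, k x < k (psi x) -> u x <= 0}.
Proof.
move=> mpsi mpsi' psiK iu mk kM kpsi inv.
have mu_ : measurable_fun setT u by exact/measurable_EFinP/(measurable_int _ iu).
pose P := [set x | 0 < u x].
have mP : measurable P.
  rewrite -[P]setTI; have := @measurable_fun_ltr _ T R setT (cst 0) u (measurable_cst _) mu_.
  by move=> /(_ measurableT [set true] I).
have m1P : measurable_fun setT (\1_P : T -> R) by exact: measurable_indic.
have P01 x : 0 <= (\1_P x : R) <= 1.
  by rewrite indicE; case: (_ \in _); rewrite ?lexx ?ler01.
have kM1 (e x : T) : `|\1_P e * k x| <= M.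
  have /andP[k0 kxM] := kM x; have /andP[P0 P1] := P01 e.
  rewrite ger0_norm ?mulr_ge0// (le_trans _ kxM)//.
  by rewrite -[leRHS]mul1r ler_wpM2r.
(* H o psi = 1_P (k o psi), because psi' undoes psi *)
pose H x := \1_P (psi' x) * k x.
have mH : measurable_fun setT H.
  by apply: measurable_funM => //; exact: measurableT_comp.
have mkpsi : measurable_fun setT (k \o psi) by exact: measurableT_comp.
have ia : mu.-integrable setT (EFin \o (fun x => u x * (\1_P x * k (psi x)))).
  exact: (@integrable_mul_bounded _ _ M iu (measurable_funM m1P mkpsi) (fun x => kM1 x (psi x))).
have ib : mu.-integrable setT (EFin \o (fun x => u x * (\1_P x * k x))).
  exact: (@integrable_mul_bounded _ _ M iu (measurable_funM m1P mk) (fun x => kM1 x x)).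
have iH : mu.-integrable setT (EFin \o (fun x => u x * H x)).
  exact: (@integrable_mul_bounded _ _ M iu mH (fun x => kM1 (psi' x) x)).
pose w x := u x * (\1_P x * k (psi x)) - u x * (\1_P x * k x).
have w0 x : 0 <= w x.
  rewrite /w -mulrBr -mulrBr indicE; case: (boolP (x \in P)) => /= [|_].
    rewrite inE => /= ux; rewrite mul1r mulr_ge0// ?subr_ge0//; exact: ltW.
  by rewrite mul0r mulr0.
have intw : \int[mu]_x w x <= 0.
  rewrite RintegralB//.
  have -> : \int[mu]_x (u x * (\1_P x * k (psi x))) = \int[mu]_x (u x * H x).
    rewrite -(inv H)//; last by move=> x; exact: kM1.
    by apply: eq_Rintegral => x _; rewrite /H psiK.
  (* pointwise, u (1_P o psi') <= u 1_P, and k >= 0 *)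
  rewrite subr_le0; apply: le_Rintegral => // x _.
  rewrite /H !indicE; have /andP[k0 _] := kM x.
  case: (boolP (x \in P)) => [|xP] /=.
    rewrite inE => /= ux; rewrite ler_wpM2l ?(ltW ux)// ler_wpM2r//.
    by case: (_ \in _).
  rewrite mul0r mulr0 mulr_le0_ge0//; last by rewrite mulr_ge0.
  by move: xP; rewrite notin_setE /= => /negP; rewrite -leNgt.
have iw : mu.-integrable setT (EFin \o w).
  by have := integrableB measurableT ia ib; apply: eq_integrable.
have mw : measurable_fun setT (EFin \o w) by exact: (measurable_int _ iw).
have intw0 : (\int[mu]_x `|(EFin \o w) x| = 0)%E.
  under eq_integral do rewrite gee0_abs ?lee_fin//=.
  have := integrable_fin_num measurableT iw; move=> /fineK <-.
  congr EFin; apply/eqP; rewrite eq_le intw/=.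
  by apply: Rintegral_ge0 => x _.
have := (ae_eq_integral_abs mu measurableT mw).1 intw0.
apply: filterS => x /(_ I)[wx0] kx; rewrite leNgt; apply/negP => ux.
move: wx0; rewrite /w -mulrBr -mulrBr indicE mem_set//= mul1r => /eqP.
by rewrite mulf_eq0 !gt_eqF// subr_gt0.
Qed.

(** The hypotheses on [u] are invariant under [u] |-> [- u]. *)
Lemma invariant_density_eq0 (psi psi' : T -> T) u k M :
  measurable_fun setT psi -> measurable_fun setT psi' -> cancel psi psi' ->
  mu.-integrable setT (EFin \o u) ->
  measurable_fun setT k -> (forall x, 0 <= k x <= M) ->
  (forall x, k x <= k (psi x)) ->
  (forall H, measurable_fun setT H -> (forall x, `|H x| <= M) ->
    \int[mu]_x (u x * H (psi x)) = \int[mu]_x (u x * H x)) ->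
  {ae mu, forall x, k x < k (psi x) -> u x = 0}.
Proof.
move=> mpsi mpsi' psiK iu mk kM kpsi inv.
have up := invariant_density_nonpos _ _ _ _ _ mpsi mpsi' psiK iu mk kM kpsi inv.
have iNu : mu.-integrable setT (EFin \o \- u).
  by have := integrableN iu; apply: eq_integrable.
have un : {ae mu, forall x, k x < k (psi x) -> - u x <= 0}.
  apply: (invariant_density_nonpos _ _ (\- u) _ _ mpsi mpsi' psiK iNu mk kM kpsi) => H mH HM.
  have E (G : T -> R) : measurable_fun setT G -> (forall x, `|G x| <= M) ->
      \int[mu]_x (- u x * G x) = - \int[mu]_x (u x * G x).
    move=> mG GM; rewrite -mulN1r -RintegralZl//; last exact: integrable_mul_bounded GM.
    by apply: eq_Rintegral => x _; rewrite mulN1r mulNr.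
  rewrite (E H)// (E (H \o psi)) => [||t]; [by rewrite inv| |exact: HM].
  exact: measurableT_comp.
apply: filterS2 up un => x ux unx kx; apply/eqP; rewrite eq_le ux//=.
by rewrite -oppr_le0 unx.
Qed.
End monotone_potential.

(** * Measurability on the circle *)

Section circle_measurability.
Context (R : realType).
Implicit Types (z : circle R) (a : R[i]).

Lemma measurable_Re : measurable_fun setT (@complex.Re R).
Proof.
move=> _ B mB; rewrite setTI; exists (B `*` setT); first exact: measurableX.
by rewrite setTI; apply/seteqP; split => z //= [].
Qed.

Lemma measurable_Im : measurable_fun setT (@complex.Im R).
Proof.
move=> _ B mB; rewrite setTI; exists (setT `*` B); first exact: measurableX.
by rewrite setTI; apply/seteqP; split => z //= [].
Qed.

Lemma measurable_fun_complex d (T : measurableType d) (f : T -> R[i]) :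
  measurable_fun setT (fun x => complex.Re (f x)) ->
  measurable_fun setT (fun x => complex.Im (f x)) ->
  measurable_fun setT f.
Proof.
move=> mRe mIm _ _ [B mB <-]; rewrite setTI setTI.
have mp : measurable_fun setT (fun x => (complex.Re (f x), complex.Im (f x))).
  exact/measurable_fun_pair.
by have := mp measurableT B mB; rewrite setTI.
Qed.

Lemma measurable_circle_val : measurable_fun setT (@circle_val R).
Proof. by move=> _ B mB; exists B. Qed.

Lemma measurable_fun_circle d (T : measurableType d) (f : T -> circle R) :
  measurable_fun setT (fun x => circle_val (f x)) -> measurable_fun setT f.
Proof.
move=> mf _ _ [B mB <-]; rewrite setTI setTI.
by have := mf measurableT B mB; rewrite setTI.
Qed.

Let x z := complex.Re (circle_val z).
Let y z := complex.Im (circle_val z).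

Lemma measurable_circle_Re : measurable_fun setT x.
Proof.
exact: (measurableT_comp measurable_Re measurable_circle_val).
Qed.

Lemma measurable_circle_Im : measurable_fun setT y.
Proof.
exact: (measurableT_comp measurable_Im measurable_circle_val).
Qed.

Lemma measurable_circle_opp : measurable_fun setT (@circle_opp R).
Proof.
apply/measurable_fun_circle/measurable_fun_complex => /=.
- rewrite (_ : (fun _ => _) = \- x); first exact: measurable_funN measurable_circle_Re.
  by apply/funext => -[[]].
- rewrite (_ : (fun _ => _) = \- y); first exact: measurable_funN measurable_circle_Im.
  by apply/funext => -[[]].
Qed.

(** The inverse is the power of exponent -1, and real powers are measurable. *)
Lemma measurable_funV_ge0 d (T : measurableType d) (f : T -> R) :
  (forall t, 0 <= f t) -> measurable_fun setT f ->
  measurable_fun setT (fun t => (f t)^-1).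
Proof.
move=> f0 mf; rewrite (_ : (fun _ => _) = (@powR R ^~ (-1)) \o f).
  exact: measurableT_comp (measurable_powR _) mf.
by apply/funext => t /=; rewrite powR_inv1.
Qed.

Lemma measurable_phi_circle a (ha : `|a| < 1) :
  measurable_fun setT (phi_circle ha).
Proof.
apply/measurable_fun_circle.
case: a ha => p q ha.
(* d1 + i d2 is the denominator 1 - conj a z, and n its inverse square norm *)
pose d1 z := (1 - (p * x z + q * y z) : R).
pose d2 z := q * x z - p * y z.
pose n z := (d1 z ^+ 2 + d2 z ^+ 2)^-1.
have mx := measurable_circle_Re.
have my := measurable_circle_Im.
have mZ (c : R) (f : circle R -> R) :
    measurable_fun setT f -> measurable_fun setT (fun z => c * f z).
  by move=> mf; apply: measurable_funM => //; exact: measurable_cst.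
have mC (c : R) (f : circle R -> R) :
    measurable_fun setT f -> measurable_fun setT (fun z => c - f z).
  by move=> mf; apply: measurable_funB => //; exact: measurable_cst.
have m1 : measurable_fun setT d1.
  by apply: mC; apply: measurable_funD; exact: mZ.
have m2 : measurable_fun setT d2 by apply: measurable_funB; exact: mZ.
have mn : measurable_fun setT n.
  apply: measurable_funV_ge0; first by move=> z; rewrite addr_ge0// sqr_ge0.
  by apply: measurable_funD; exact: measurable_funX.
apply/measurable_fun_complex.
- rewrite (_ : (fun _ => _) = (fun z => ((p - x z) * d1 z + (q - y z) * d2 z) * n z)).
    apply: measurable_funM => //; apply: measurable_funD;
      apply: measurable_funM => //; exact: mC.
  apply/funext => -[[u v] uv]; rewrite /n /d1 /d2 /= /phi /= /x /y /=.
  have -> : 1 - (p * u - - q * v) = 1 - (p * u + q * v) by ring.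
  have -> : 0 - (p * v + - q * u) = q * u - p * v by ring.
  by move: (_ ^-1) => N; ring.
- rewrite (_ : (fun _ => _) = (fun z => ((q - y z) * d1 z - (p - x z) * d2 z) * n z)).
    apply: measurable_funM => //; apply: measurable_funB;
      apply: measurable_funM => //; exact: mC.
  apply/funext => -[[u v] uv]; rewrite /n /d1 /d2 /= /phi /= /x /y /=.
  have -> : 1 - (p * u - - q * v) = 1 - (p * u + q * v) by ring.
  have -> : 0 - (p * v + - q * u) = q * u - p * v by ring.
  by move: (_ ^-1) => N; ring.
Qed.

Lemma measurable_circle_line (p q : R) :
  measurable [set z | p * y z = q * x z].
Proof.
have := measurable_fun_eqr
  (measurable_funM (measurable_cst p) measurable_circle_Im)
  (measurable_funM (measurable_cst q) measurable_circle_Re).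
move=> /(_ measurableT [set true] I); rewrite setTI.
by congr measurable; apply/seteqP; split => z /= /eqP.
Qed.
End circle_measurability.

(** * Arc length: rotation by a half turn, null sets *)

Section circle_measure.
Context (R : realType).
Local Notation leb := (@lebesgue_measure R).
Local Notation m := (@mcircle R).

(** Both sides are measures that agree on half-open intervals, where the
    uniqueness of the Lebesgue measure applies. *)
Lemma lebesgue_measure_translate (c : R) (A : set (measurableTypeR R)) :
  measurable A -> leb ((fun t => t + c) @^-1` A) = leb A.
Proof.
move=> mA.
have mc : measurable_fun [set: measurableTypeR R]
    ((fun t => t + c) : measurableTypeR R -> measurableTypeR R).
  exact: (@measurable_funD _ _ R setT id (cst c)).
pose f : {mfun measurableTypeR R >-> measurableTypeR R} :=
  HB.pack (fun t : measurableTypeR R => t + c : measurableTypeR R)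
    (isMeasurableFun.Build _ _ _ _ _ mc).
symmetry; apply: (@lebesgue_measure_unique R (pushforward leb f) _ A mA).
move=> X [[a b]] /= _ <-.
rewrite /pushforward.
have -> : (fun t => t + c) @^-1` `]a, b] = `](a - c), (b - c)]%classic.
  by apply/seteqP; split => t /=; rewrite !in_itv/= ltrBlDr lerBrDr.
rewrite !lebesgue_measure_itv/= !lte_fin ltrD2r; case: ifP => // _.
by rewrite -!EFinD; congr EFin; ring.
Qed.

(** The half-open interval is a fundamental domain for the translations by
    [2 * pi]; its closure, on which the uniform law is defined, is not. *)
Lemma uniform_probE (A : set (measurableTypeR R)) : measurable A ->
  uniform_prob (pi2_gt0 R) A =
  ((2 * pi)^-1%:E * leb (A `&` `[0%R, (2 * pi)%R[))%E.
Proof.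
move=> mA; rewrite /uniform_prob integral_uniform_pdf.
rewrite (eq_integral (fun=> ((2 * pi)^-1)%:E)); last first.
  move=> t; rewrite inE/= => -[_]; rewrite in_itv/= /uniform_pdf => ->.
  by rewrite subr0.
rewrite integral_cst//=; last exact: measurableI.
congr (_ * _)%E.
have -> : A `&` `[0, 2 * pi] = (A `&` `[0, 2 * pi[) `|` (A `&` [set 2 * pi]).
  rewrite -setIUr; congr (_ `&` _); rewrite setUitv1// bnd_simp ltW//.
  exact: pi2_gt0.
apply: (@measureU0 _ _ _ leb); [exact: measurableI|exact: measurableI|].
apply/eqP; rewrite eq_le measure_ge0 andbT -(lebesgue_measure_set1 (2 * pi)).
apply: le_measure; rewrite ?inE; last exact: subIsetr.
  exact: measurableI.
exact: measurable_set1.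
Qed.

Lemma expiDpi (t : R) : expi (t + pi) = circle_opp (expi t).
Proof.
apply/val_inj => /=; rewrite cosDpi sinDpi.
by apply/eqP; rewrite eq_complex/= !eqxx.
Qed.

(** In the angle, z |-> - z is the translation by [pi], which exchanges the two
    halves of the period up to the translation by [2 * pi]. *)
Lemma mcircle_opp (A : set (circle R)) : measurable A ->
  m (@circle_opp R @^-1` A) = m A.
Proof.
move=> mA; rewrite /mcircle /distribution/= /pushforward.
have mE := @measurable_expi R.
pose B : set (measurableTypeR R) := @expi R @^-1` A.
pose B' : set (measurableTypeR R) := @expi R @^-1` (@circle_opp R @^-1` A).
have mB : measurable B by rewrite -[B]setTI; exact: mE.
have mB' : measurable B'.
  rewrite -[B']setTI; apply: mE => //; rewrite -[X in measurable X]setTI.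
  exact: measurable_circle_opp.
have B'E t : B' t <-> B (t + pi) by rewrite /B /B' /= expiDpi.
have BE t : B (t + pi) <-> B (t - pi).
  rewrite -[t in t + pi](subrK pi t) /B/= !expiDpi.
  by rewrite (_ : circle_opp (circle_opp _) = expi (t - pi))//; apply/val_inj; rewrite /= opprK.
rewrite [LHS](uniform_probE B' mB') [RHS](uniform_probE B mB).
congr (_ * _)%E.
have pi0 := pi_gt0 R.
have E0 : `[0, 2 * pi[%classic = `[0, pi[ `|` `[pi, 2 * pi[ :> set R.
  by apply/seteqP; split => t /=; rewrite !in_itv/=; lra.
have split (C : set (measurableTypeR R)) : measurable C ->
    leb (C `&` `[0, 2 * pi[) = (leb (C `&` `[0%R, pi[) + leb (C `&` `[pi, (2 * pi)%R[))%E.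
  move=> mC; rewrite E0 setIUr measureU//; do ?exact: measurableI.
  apply/seteqP; split => t //= [[_]]; rewrite in_itv/= => /andP[_ t1] [_].
  by rewrite in_itv/= leNgt t1.
rewrite (split _ mB) (split _ mB') addeC; congr (_ + _)%E.
- rewrite -[RHS](lebesgue_measure_translate (- pi)); last exact: measurableI.
  congr (leb _); apply/seteqP; split => t /=; rewrite !in_itv/= => -[Bt tI].
    by split; [exact/BE/B'E|lra].
  by split; [exact/B'E/BE|lra].
- rewrite -[RHS](lebesgue_measure_translate pi); last exact: measurableI.
  congr (leb _); apply/seteqP; split => t /=; rewrite !in_itv/= => -[Bt tI].
    by split; [exact/B'E|lra].
  by split; [exact/B'E|lra].
Qed.

(** Two angles of points on the same line through 0 satisfy sin (t1 - t2) = 0,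
    hence each half-period contains at most one of them. *)
Lemma mcircle_line0 (p q : R) : (p, q) != (0, 0) ->
  m [set z | p * complex.Im (circle_val z) = q * complex.Re (circle_val z)] = 0%E.
Proof.
move=> pq0; rewrite /mcircle /distribution/= /pushforward.
set S := _ @^-1` _.
have SE t : S t -> p * sin t = q * cos t by [].
have sub1 (b : R) : is_subset1 (S `&` `[b, (b + pi)%R[).
  move=> t1 t2 [/SE e1 +] [/SE e2 +]; rewrite /= !in_itv/= => i1 i2.
  have s0 : sin (t1 - t2) = 0.
    have ps : p * sin (t1 - t2) = 0.
      rewrite sinB (_ : _ * _ = cos t2 * (p * sin t1) - cos t1 * (p * sin t2)); last by ring.
      by rewrite e1 e2; ring.
    have qs : q * sin (t1 - t2) = 0.
      rewrite sinB (_ : _ * _ = sin t1 * (q * cos t2) - sin t2 * (q * cos t1)); last by ring.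
      by rewrite -e1 -e2; ring.
    move: pq0; rewrite xpair_eqE negb_and => /orP[] h.
      by move/eqP: ps; rewrite mulf_eq0 (negbTE h) => /eqP.
    by move/eqP: qs; rewrite mulf_eq0 (negbTE h) => /eqP.
  have [h|h|//] := ltgtP t1 t2.
  - have : 0 < sin (t2 - t1) by apply: sin_gt0_pi; lra.
    by rewrite -opprB sinN s0 oppr0 ltxx.
  - have : 0 < sin (t1 - t2) by apply: sin_gt0_pi; lra.
    by rewrite s0 ltxx.
have null (b : R) : leb (S `&` `[b, (b + pi)%R[) = 0%E.
  apply: countable_lebesgue_measure0.
  have [->//|/set0P[t St]] := eqVneq (S `&` `[b, (b + pi)[) set0.
  apply: (sub_countable _ (countable1 t)); apply: subset_card_le => s Ss.
  exact: sub1 Ss St.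
have mS : measurable S.
  rewrite -[S]setTI; apply: (@measurable_expi R) => //.
  exact: measurable_circle_line.
rewrite [LHS](uniform_probE S mS) (_ : leb _ = 0%E) ?mule0//.
apply/eqP; rewrite eq_le measure_ge0 andbT.
have pi0 := pi_gt0 R.
rewrite -[leRHS](adde0 0%E) -{1}(null 0) -(null pi).
apply: (@le_trans _ _ (leb (S `&` `[0, (0 + pi)%R[ `|` S `&` `[pi, (pi + pi)%R[))).
  apply: le_measure; rewrite ?inE; [exact: measurableI| |].
    by apply: measurableU; exact: measurableI.
  by rewrite -setIUr; apply: setIS => t /=; rewrite !in_itv/=; lra.
by apply: measureU2; exact: measurableI.
Qed.
End circle_measure.

(** * A potential increasing along psi *)

Section potential.
Context (R : realType).
Implicit Types (z : circle R) (a : R[i]).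

Lemma circle_ReIm z :
  complex.Re (circle_val z) ^+ 2 + complex.Im (circle_val z) ^+ 2 = 1.
Proof.
have := add_Re2_Im2 (circle_val z); rewrite norm_circle expr1n.
by move=> /(congr1 (@complex.Re R)).
Qed.

Lemma disc_ReIm a : `|a| < 1 -> complex.Re a ^+ 2 + complex.Im a ^+ 2 < 1.
Proof.
move=> ha; rewrite -ltcR add_Re2_Im2.
by rewrite expr_lt1.
Qed.

Lemma circle_oppK : involutive (@circle_opp R).
Proof. by move=> z; apply/val_inj; rewrite /= opprK. Qed.

Lemma phi_denom_neq0 a z : `|a| < 1 -> 1 - conjc a * circle_val z != 0.
Proof.
move=> ha; rewrite subr_eq0; apply: contraTneq ha => /(congr1 Num.norm).
by rewrite normrM normcJ norm_circle mulr1 normr1 => <-; rewrite ltxx.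
Qed.

Lemma phi_circleK a (ha : `|a| < 1) : involutive (phi_circle ha).
Proof.
move=> z; apply/val_inj; rewrite /= /phi.
have d0 := phi_denom_neq0 a z ha.
have a1 : 1 - conjc a * a != 0.
  by rewrite mulrC -sqr_normc subr_eq0 eq_sym lt_eqF// expr_lt1.
set b := conjc a in d0 a1 *; set w := circle_val z in d0 *.
(* numerator and denominator of phi_a (phi_a z) *)
have -> : a - (a - w) / (1 - b * w) = w * (1 - b * a) / (1 - b * w) by field.
have -> : 1 - b * ((a - w) / (1 - b * w)) = (1 - b * a) / (1 - b * w) by field.
by field; apply/andP.
Qed.

(** The height of [z] in the direction of [a], shifted to be nonnegative; the
    direction is that of the attracting fixed point of psi. *)
Definition potential a z : R := 1 + complex.Re (conjc a * circle_val z).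

Lemma sqr_norm_conjM a z :
  complex.Re (conjc a * circle_val z) ^+ 2 + complex.Im (conjc a * circle_val z) ^+ 2 =
  complex.Re a ^+ 2 + complex.Im a ^+ 2.
Proof.
rewrite -[RHS]mulr1 -(circle_ReIm z).
by case: z => -[x y] /= _; case: a => p q /=; ring.
Qed.

Lemma potential_bound a z : `|a| < 1 -> 0 <= potential a z <= 2.
Proof.
move=> /disc_ReIm; rewrite -(sqr_norm_conjM a z) /potential.
set s := complex.Re _; set t := complex.Im _ => st.
have s1 : s ^+ 2 <= 1 by have := sqr_ge0 t; lra.
by apply/andP; split; rewrite leNgt; apply/negP; nra.
Qed.

(** With w = conj a z, conj a psi(z) = (|w|^2 + w) / (1 + w), since |w| = |a|;
    take the real part and subtract Re w. *)
Lemma potential_phi_opp a (ha : `|a| < 1) z :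
  let s := complex.Re (conjc a * circle_val z) in
  let t := complex.Im (conjc a * circle_val z) in
  0 < (1 + s) ^+ 2 + t ^+ 2 /\
  potential a (phi_circle ha (circle_opp z)) =
    potential a z + 2 * t ^+ 2 / ((1 + s) ^+ 2 + t ^+ 2).
Proof.
have st1 := disc_ReIm _ ha; have st := sqr_norm_conjM a z.
have E : (complex.Re a ^+ 2 + complex.Im a ^+ 2)%:C%C = conjc a * a :> R[i].
  by rewrite add_Re2_Im2 sqr_normc mulrC.
rewrite -st in st1 E; rewrite /potential /= /phi mulrN !opprK mulrA mulrDr -E.
move: st1; case: (conjc a * circle_val z) => s t /= st1.
have d0 : 0 < (1 + s) ^+ 2 + t ^+ 2 by nra.
split=> //; rewrite add0r -[RHS]addrA; congr (1 + _).
by field; rewrite gt_eqF.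
Qed.

Lemma measurable_potential a : measurable_fun setT (potential a).
Proof.
case: a => p q.
rewrite (_ : potential _ = (fun z =>
    1 + (p * complex.Re (circle_val z) + q * complex.Im (circle_val z)))).
  apply: measurable_funD; first exact: measurable_cst.
  apply: measurable_funD; apply: measurable_funM; try exact: measurable_cst.
    exact: measurable_circle_Re.
  exact: measurable_circle_Im.
by apply/funext => -[[u v] uv]; rewrite /potential/=; ring.
Qed.

Lemma potential_incr_ae a (ha : `|a| < 1) : a != 0 ->
  {ae mcircle R, forall z,
    potential a z < potential a (phi_circle ha (circle_opp z))}.
Proof.
move=> a0.
have pq : (complex.Re a, complex.Im a) != (0, 0).
  by move: a0; case: (a) => p q; rewrite eq_complex.
exists [set z | complex.Re a * complex.Im (circle_val z) =
                complex.Im a * complex.Re (circle_val z)].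
split; last 1 first.
- move=> z /= /negP; rewrite -leNgt.
  have [d0 ->] := potential_phi_opp a ha z.
  rewrite gerDl => h; apply/eqP; rewrite -subr_eq0 -sqrf_eq0.
  have -> : complex.Re a * complex.Im (circle_val z) -
      complex.Im a * complex.Re (circle_val z) = complex.Im (conjc a * circle_val z).
    by case: (a) => p q; case: (circle_val z) => u v /=; ring.
  rewrite eq_le sqr_ge0 andbT.
  by move: h; rewrite pmulr_lle0 ?invr_gt0// pmulr_rle0.
- exact: measurable_circle_line.
- exact: mcircle_line0.
Qed.
End potential.
Arguments potential {R} a z.

(** * Densities twisted by a sign *)

Section circle_invariance.
Context (R : realType).
Local Notation m := (mcircle R).
Implicit Types (z : circle R) (a : R[i]) (u H : circle R -> R).

Lemma ae_circle_opp (P : circle R -> Prop) :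
  {ae m, forall z, P z} -> {ae m, forall z, P (circle_opp z)}.
Proof.
move=> [N [mN N0 PN]]; exists (@circle_opp R @^-1` N); split.
- by rewrite -[X in measurable X]setTI; exact: measurable_circle_opp.
- by rewrite -[RHS]N0; exact: mcircle_opp.
- by move=> z /= Pz; exact: PN.
Qed.

Lemma Rintegral_circle_opp u :
  measurable_fun setT u -> m.-integrable setT (EFin \o (u \o @circle_opp R)) ->
  \int[m]_z u (circle_opp z) = \int[m]_z u z.
Proof.
move=> mu_ iu.
have mo := @measurable_circle_opp R.
pose o : {mfun circle R >-> circle R} :=
  HB.pack (@circle_opp R) (isMeasurableFun.Build _ _ _ _ _ mo).
have mEu : measurable_fun setT (EFin \o u) by exact/measurable_EFinP.
congr fine; transitivity (\int[pushforward m o]_z (EFin \o u) z)%E.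
  exact/esym/(@integral_pushforward _ _ _ _ _ _ mo m setT (EFin \o u)).
by apply: eq_measure_integral => A mA _; exact: mcircle_opp.
Qed.

(** The sign picked up by [phi_circle ha] and the one picked up by z |-> - z
    cancel, so that the density is invariant under their composite. *)
Lemma twisted_invariant_eq0 a (ha : `|a| < 1) (eps : R) u :
  a != 0 -> eps ^+ 2 = 1 -> m.-integrable setT (EFin \o u) ->
  {ae m, forall z, u (circle_opp z) = eps * u z} ->
  (forall H (M : R), measurable_fun setT H -> (forall z, `|H z| <= M) ->
    \int[m]_z (u z * H z) = eps * \int[m]_z (u z * H (phi_circle ha z))) ->
  {ae m, forall z, u z = 0}.
Proof.
move=> a0 eps1 iu uopp uphi.
have mphi := measurable_phi_circle _ _ ha; have mopp := @measurable_circle_opp R.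
have mu_ : measurable_fun setT u by exact/measurable_EFinP/(measurable_int _ iu).
pose psi z := phi_circle ha (circle_opp z).
pose psi' z := circle_opp (phi_circle ha z).
have psiK : cancel psi psi'.
  by move=> z; rewrite /psi/psi' phi_circleK circle_oppK.
have mpsi : measurable_fun setT psi by exact: measurableT_comp.
have mpsi' : measurable_fun setT psi' by exact: measurableT_comp.
have inv H : measurable_fun setT H -> (forall z, `|H z| <= 2) ->
    \int[m]_z (u z * H (psi z)) = \int[m]_z (u z * H z).
  move=> mH H2.
  have mHphi : measurable_fun setT (H \o phi_circle ha) by exact: measurableT_comp.
  have mHpsi : measurable_fun setT (H \o psi) by exact: measurableT_comp.
  pose G z := u (circle_opp z) * H (phi_circle ha z).
  have mG : measurable_fun setT G.
    by apply: measurable_funM => //; exact: measurableT_comp.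
  have GE z : u z * H (psi z) = G (circle_opp z) by rewrite /G circle_oppK.
  under eq_Rintegral do rewrite GE.
  rewrite Rintegral_circle_opp//; last first.
    apply: eq_integrable (integrable_mul_bounded _ _ _ _ u _ 2 iu mHpsi _) => //.
      by move=> z _ /=; rewrite GE.
    by move=> z; exact: H2.
  rewrite (uphi _ 2)// -RintegralZl//; last first.
    by apply: (integrable_mul_bounded _ _ _ _ u _ 2 iu mHphi) => z; exact: H2.
  congr fine; apply: ae_eq_integral => //.
  - exact/measurable_EFinP.
  - apply/measurable_EFinP; apply: measurable_funM; first exact: measurable_cst.
    exact: measurable_funM.
  - by apply: filterS uopp => z uz _; rewrite /G uz mulrA.
have kM z := potential_bound _ a z ha.
have kpsi z : potential a z <= potential a (psi z).
  have [d0 ->] := potential_phi_opp _ a ha z.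
  by rewrite lerDl divr_ge0 ?(ltW d0)// mulr_ge0// sqr_ge0.
have := invariant_density_eq0 _ _ _ _ psi psi' u _ 2 mpsi mpsi' psiK iu
  (measurable_potential _ a) kM kpsi inv.
by apply: filterS2 (potential_incr_ae _ a ha a0) => z kz; apply.
Qed.
End circle_invariance.

(** * From the space of square-integrable functions to real densities *)

Section L2_circle.
Context (R : realType).
Local Notation m := (mcircle R).
Implicit Types (z : circle R) (a : R[i]) (f g : circle R -> R[i]) (H : circle R -> R).

Lemma L2_measurable_Re f : L2 f -> measurable_fun setT (fun z => complex.Re (f z)).
Proof. by case=> mf _; exact: measurableT_comp (measurable_Re R) mf. Qed.

Lemma L2_measurable_Im f : L2 f -> measurable_fun setT (fun z => complex.Im (f z)).
Proof. by case=> mf _; exact: measurableT_comp (measurable_Im R) mf. Qed.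

Lemma sqr_normcE (w : R[i]) :
  Normc.normc w ^+ 2 = complex.Re w ^+ 2 + complex.Im w ^+ 2.
Proof. by case: w => p q /=; rewrite sqr_sqrtr// addr_ge0// sqr_ge0. Qed.

(** The circle has finite measure: |u| <= 1 + u^2 <= 1 + |f|^2. *)
Lemma L2_integrable f (u : circle R -> R) : L2 f -> measurable_fun setT u ->
  (forall z, (u z) ^+ 2 <= Normc.normc (f z) ^+ 2) ->
  m.-integrable setT (EFin \o u).
Proof.
move=> Lf mu_ uf; have mRe := L2_measurable_Re f Lf; have mIm := L2_measurable_Im f Lf.
have mn : measurable_fun setT (fun z => Normc.normc (f z) ^+ 2).
  rewrite (_ : (fun _ => _) = (fun z => complex.Re (f z) ^+ 2 + complex.Im (f z) ^+ 2)).
    by apply: measurable_funD; exact: measurable_funX.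
  by apply/funext => z; rewrite sqr_normcE.
have iS : m.-integrable setT (fun z => (Normc.normc (f z) ^+ 2)%:E).
  apply/integrableP; split; first exact/measurable_EFinP.
  under eq_integral do rewrite gee0_abs ?lee_fin ?sqr_ge0//.
  by case: Lf.
have i1 : m.-integrable setT (EFin \o cst (1:R)).
  exact: finite_measure_integrable_cst.
have := integrableD measurableT i1 iS.
apply: le_integrable => //; first exact/measurable_EFinP.
move=> z _ /=; rewrite lee_fin [leRHS]ger0_norm ?addr_ge0 ?sqr_ge0//.
have := uf z; have : 0 <= (`|u z| - 1) ^+ 2 by exact: sqr_ge0.
have := real_normK (num_real (u z)); have := normr_ge0 (u z).
nra.
Qed.

Lemma L2_integrable_Re f : L2 f -> m.-integrable setT (EFin \o (fun z => complex.Re (f z))).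
Proof.
move=> Lf; apply: (L2_integrable f) => //; first exact: L2_measurable_Re.
by move=> z; rewrite sqr_normcE lerDl sqr_ge0.
Qed.

Lemma L2_integrable_Im f : L2 f -> m.-integrable setT (EFin \o (fun z => complex.Im (f z))).
Proof.
move=> Lf; apply: (L2_integrable f) => //; first exact: L2_measurable_Im.
by move=> z; rewrite sqr_normcE lerDr sqr_ge0.
Qed.

Lemma L2_bounded H M : measurable_fun setT H -> (forall z, `|H z| <= M) ->
  L2 (fun z => (H z)%:C%C).
Proof.
move=> mH HM; split.
  by apply: measurable_fun_complex => //=; exact: measurable_cst.
under eq_integral do rewrite sqr_normcE /= expr0n addr0.
apply: (@le_lt_trans _ _ (\int[m]_(z in setT) (M ^+ 2)%:E)%E).
  apply: ge0_le_integral => //.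
  - by move=> z _; rewrite lee_fin sqr_ge0.
  - exact/measurable_EFinP/measurable_funX.
  - by move=> z _; rewrite lee_fin -(real_normK (num_real (H z)));
      rewrite lerXn2r ?nnegrE// (le_trans _ (HM z)).
by rewrite integral_cst// [X in (_ * X)%E]probability_setT mule1 ltry.
Qed.

Lemma L2_dot_real f H :
  L2_dot f (fun z => (H z)%:C%C) =
  Complex (\int[m]_z (complex.Re (f z) * H z)) (\int[m]_z (complex.Im (f z) * H z)).
Proof.
rewrite /L2_dot/cintegral; congr Complex; apply: eq_Rintegral => z _;
  case: (f z) => p q /=; ring.
Qed.

(** The test functions are real, so the real and the imaginary part of [f]
    satisfy the orthogonality relations separately. *)
Lemma L2_orth_twisted_eq0 a (ha : `|a| < 1) (eps : R) f :
  a != 0 -> eps ^+ 2 = 1 -> L2 f ->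
  f \o @circle_opp R = (fun z => eps%:C%C * f z) %[ae m] ->
  (forall H (M : R), measurable_fun setT H -> (forall z, `|H z| <= M) ->
    L2_dot f (fun z => (H z - eps * H (phi_circle ha z))%:C%C) = 0) ->
  f = (fun=> 0) %[ae m].
Proof.
move=> a0 eps1 Lf fopp forth.
have twisted (u : circle R -> R) H M : m.-integrable setT (EFin \o u) ->
    measurable_fun setT H -> (forall z, `|H z| <= M) ->
    \int[m]_z (u z * (H z - eps * H (phi_circle ha z))) = 0 ->
    \int[m]_z (u z * H z) = eps * \int[m]_z (u z * H (phi_circle ha z)).
  move=> iu mH HM.
  have mHp : measurable_fun setT (H \o phi_circle ha).
    by apply: measurableT_comp => //; exact: measurable_phi_circle.
  have i1 := integrable_mul_bounded _ _ _ _ u _ M iu mH HM.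
  have i2 : m.-integrable setT (EFin \o (fun z => u z * H (phi_circle ha z))).
    by apply: (integrable_mul_bounded _ _ _ _ u _ M iu mHp) => z; exact: HM.
  have i3 : m.-integrable setT (EFin \o (fun z => eps * (u z * H (phi_circle ha z)))).
    by have := integrableZl measurableT eps i2; apply: eq_integrable.
  under eq_Rintegral do rewrite mulrBr mulrCA.
  by rewrite RintegralB// RintegralZl// => /eqP; rewrite subr_eq0 => /eqP.
have re0 : {ae m, forall z, complex.Re (f z) = 0}.
  apply: (twisted_invariant_eq0 _ _ ha eps _ a0 eps1 (L2_integrable_Re f Lf)).
    apply: filterS fopp => z /(_ I) /= ->.
    by case: (f z) => p q /=; ring.
  move=> H M mH HM; apply: (twisted _ _ M) => //; first exact: L2_integrable_Re.
  by have := forth H M mH HM; rewrite L2_dot_real => -[].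
have im0 : {ae m, forall z, complex.Im (f z) = 0}.
  apply: (twisted_invariant_eq0 _ _ ha eps _ a0 eps1 (L2_integrable_Im f Lf)).
    apply: filterS fopp => z /(_ I) /= ->.
    by case: (f z) => p q /=; ring.
  move=> H M mH HM; apply: (twisted _ _ M) => //; first exact: L2_integrable_Im.
  by have := forth H M mH HM; rewrite L2_dot_real => -[].
apply: filterS2 re0 im0 => z.
by case: (f z) => p q /= -> ->.
Qed.

Lemma L2_zero_orth f (S : set (circle R -> R[i])) :
  S `<=` @L2 R -> L2_zero R f -> L2_orth S f.
Proof.
move=> SL [Lf f0]; split=> // g /SL Lg.
have fRe := L2_measurable_Re f Lf; have fIm := L2_measurable_Im f Lf.
have gRe := L2_measurable_Re g Lg; have gIm := L2_measurable_Im g Lg.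
have int0 (u : circle R -> R) : measurable_fun setT u -> {ae m, forall z, u z = 0} ->
    \int[m]_z u z = 0.
  move=> mu_ u0; rewrite /Rintegral (ae_eq_integral (cst 0%E)) ?integral0//.
    exact/measurable_EFinP.
  by apply: filterS u0 => z uz _ /=; rewrite uz.
rewrite /L2_dot /cintegral !int0//.
- rewrite (_ : (fun _ => _) = (fun z =>
    complex.Im (f z) * complex.Re (g z) - complex.Re (f z) * complex.Im (g z))).
    by apply: measurable_funB; exact: measurable_funM.
  by apply/funext => z; case: (f z) (g z) => [p q] [s t] /=; ring.
- by apply: filterS f0 => z /(_ I) ->; rewrite mul0r.
- rewrite (_ : (fun _ => _) = (fun z =>
    complex.Re (f z) * complex.Re (g z) + complex.Im (f z) * complex.Im (g z))).
    by apply: measurable_funD; exact: measurable_funM.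
  by apply/funext => z; case: (f z) (g z) => [p q] [s t] /=; ring.
- by apply: filterS f0 => z /(_ I) ->; rewrite mul0r.
Qed.

Lemma ae_eq0_circle_opp f : f = (fun=> 0) %[ae m] ->
  {ae m, forall z, f z = 0 /\ f (circle_opp z) = 0}.
Proof.
move=> f0; have f0' : {ae m, forall z, f z = 0} by apply: filterS f0 => z; apply.
by apply: filterS2 f0' (ae_circle_opp R (fun z => f z = 0) f0').
Qed.

Lemma L2_zero_even f : L2_zero R f -> L2_even R f.
Proof.
move=> [Lf f0]; split=> //.
by apply: filterS (ae_eq0_circle_opp f f0) => z [h h'] _ /=; rewrite h h'.
Qed.

Lemma L2_zero_odd f : L2_zero R f -> L2_odd R f.
Proof.
move=> [Lf f0]; split=> //.
by apply: filterS (ae_eq0_circle_opp f f0) => z [h h'] _ /=; rewrite h h' oppr0.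
Qed.
End L2_circle.

Theorem theorem5p7 (R : realType) (a : R[i]) (ha : `|a| < 1) (a0 : a != 0) :
  L2_orth (L2_null (fun f => comp_phi ha f \+ f)) `&` L2_even R = L2_zero R /\
  L2_orth (L2_null (fun f => comp_phi ha f \- f)) `&` L2_odd R = L2_zero R.
Proof.
(* for eps = 1 or -1, composing this function with phi_a multiplies it by - eps *)
have test (eps : R) (H : circle R -> R) M : measurable_fun setT H ->
    (forall z, `|H z| <= M) ->
    L2 (fun z => (H z - eps * H (phi_circle ha z))%:C%C).
  move=> mH HM; apply: (L2_bounded _ _ (M + `|eps| * M)).
    apply: measurable_funB => //; apply: measurable_funM; first exact: measurable_cst.
    by apply: measurableT_comp => //; exact: measurable_phi_circle.
  move=> z; rewrite (le_trans (ler_normB _ _))// normrM lerD// ler_wpM2l//.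
split; apply/seteqP; split => f.
- move=> [[Lf orth] [_ fopp]]; split=> //.
  apply: (L2_orth_twisted_eq0 _ _ ha 1 f a0 (expr1n _ _) Lf).
    by apply: filterS fopp => z h /h /= ->; rewrite mul1r.
  move=> H M mH HM; apply: orth; split; first exact: test HM.
  apply: aeW => z _ /=; rewrite /comp_phi /= phi_circleK -rmorphD/=.
  by congr Complex; ring.
- move=> f0; split; last exact: L2_zero_even.
  by apply: L2_zero_orth f0 => g [].
- move=> [[Lf orth] [_ fopp]]; split=> //.
  apply: (L2_orth_twisted_eq0 _ _ ha (-1) f a0 _ Lf); first by rewrite sqrrN expr1n.
    by apply: filterS fopp => z h /h /= ->; rewrite rmorphN1 mulN1r.
  move=> H M mH HM; apply: orth; split; first exact: test HM.
  apply: aeW => z _ /=; rewrite /comp_phi /= phi_circleK -rmorphB/=.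
  by congr Complex; ring.
- move=> f0; split; last exact: L2_zero_odd.
  by apply: L2_zero_orth f0 => g [].
Qed.
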